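(* Let $q$ be a prime power and let $G=1+\mathfrak{a}$ be a pattern group over $\mathbb{F}_q$ with pattern algebra $\mathfrak{a}$. Then the number of (complex) irreducible characters of $G$ of degree $q$ equals the number of coadjoint orbits of $G$ on $\mathfrak{a}^*$ of cardinality $q^2$.
   Context: A closed set $D\subseteq\{(i,j):1\le i<j\le n\}$ is one such that $(i,j),(j,k)\in D$ implies $(i,k)\in D$; the pattern algebra $\mathfrak{a}=\mathfrak{g}_D$ is the $\mathbb{F}_q$-span of the elementary matrices $E_{ij}$, $(i,j)\in D$, and $G=1+\mathfrak{a}$ is the pattern group. The coadjoint action of $G$ on $\mathfrak{a}^*$ is $(\mathrm{Ad}^*(g)\lambda)(X)=\lambda(g^{-1}Xg)$ for $g\in G$, $\lambda\in\mathfrak{a}^*$, $X\in\mathfrak{a}$. *)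

(* Defs.v *)
From HB Require Import structures.
From mathcomp Require Import all_boot all_order all_algebra all_fingroup all_solvable all_field all_character.
Set Implicit Arguments. Unset Strict Implicit. Unset Printing Implicit Defensive.
Import GRing.Theory.
Local Open Scope ring_scope.

Section Pattern.
Variables (F : finFieldType) (n : nat).
Notation mat := 'M[F]_(n.+1).

Definition closed_pattern (D : rel 'I_n.+1) : Prop :=
  (forall i j, D i j -> (i < j)%N) /\ (forall i j k, D i j -> D j k -> D i k).

Definition in_patalg (D : rel 'I_n.+1) (A : mat) : bool :=
  [forall i, [forall j, ~~ D i j ==> (A i j == 0)]].

Definition patgroup_set (D : rel 'I_n.+1) : {set {'GL_n.+1[F]}} :=
  [set g : {'GL_n.+1[F]} | in_patalg D (GLval g - 1%:M)].

(* a* : a linear functional on a is encoded as a function on matrices that is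
   linear on a and identically 0 outside a (i.e. a function on a, extended by 0) *)
Definition is_dual (D : rel 'I_n.+1) (f : {ffun mat -> F}) : bool :=
  [forall X, ~~ in_patalg D X ==> (f X == 0)] &&
  [forall c : F, [forall X, [forall Y,
     (in_patalg D X && in_patalg D Y) ==> (f (c *: X + Y) == c * f X + f Y)]]].

Definition dual_set (D : rel 'I_n.+1) : {set {ffun mat -> F}} :=
  [set f | is_dual D f].

Definition coadj (D : rel 'I_n.+1) (g : {'GL_n.+1[F]}) (f : {ffun mat -> F})
  : {ffun mat -> F} :=
  [ffun X => if in_patalg D X then f (GLval g^-1 *m X *m GLval g) else 0].

Definition coadj_orbit (D : rel 'I_n.+1) (G : {set {'GL_n.+1[F]}})
  (f : {ffun mat -> F}) : {set {ffun mat -> F}} :=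
  [set coadj D g f | g in G].

Definition coadj_orbits (D : rel 'I_n.+1) (G : {set {'GL_n.+1[F]}}) :=
  [set coadj_orbit D G f | f in dual_set D].

End Pattern.

(* Main.v *)
Require Import Defs.
From HB Require Import structures.
From mathcomp Require Import all_boot all_order all_algebra all_fingroup all_solvable all_field all_character.
Set Implicit Arguments. Unset Strict Implicit. Unset Printing Implicit Defensive.
Import GRing.Theory Num.Theory FinRing.Theory GroupScope.
Local Open Scope ring_scope.

(* For [(i, k)] in [D] let an intermediate vertex be a [j] with [(i, j)] and
   [(j, k)] in [D], and let [J] be the set of pairs with at least two of them.
   If [j != j'] are intermediate for [(i, k)], the root elements of [(i, j)],
   [(j, k)], [(i, j')], [(j', k)] and [(i, k)] generate a Heisenberg-like group
   whose characters nontrivial on the centre have degree [q ^ 2], where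
   [q = #|F|], and likewise a functional nonzero at [E_ik] has an orbit of size
   larger than [q ^ 2].  Hence both sides of the identity only see the quotient
   [A] of the pattern algebra by the span of [J], in which every product of
   three elements vanishes.

   There [1 + A ^ 2] is central and the commutator of [1 + x] and [1 + y] is
   [1 + (x y - y x)].  With [psi] a fixed nontrivial character of [(F, +)], an
   irreducible character [chi] lies over a central character [psi \o lambda] for
   a functional [lambda] on [A ^ 2]; the centre ['Z(chi)] is [1 + R] where [R] is
   the radical of [(x, y) |-> lambda (x y - y x)], so that [chi(1) ^ 2] is the
   index of [1 + R].  But [1 + R] is also the coadjoint stabiliser of every
   extension of [lambda].  Counting pairs [(lambda, chi)] gives the theorem. *)

(** * Additive characters of a finite field *)

Section AdditiveCharacters.

(** Translation by [s] permutes [S] and multiplies the sum by [h s], which is not [1]. *)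
Lemma sum_nontrivial_addchar (V : finZmodType) (S : {set V}) (s : V)
    (h : V -> algC) :
    (forall x, (s + x \in S) = (x \in S)) ->
    {in S, forall x, h (s + x) = h s * h x} -> h s != 1 ->
  \sum_(x in S) h x = 0.
Proof.
move=> Ss hM hs1; apply/eqP; move: hs1; rewrite -subr_eq0 => hs1.
rewrite -(inj_eq (mulfI hs1)) mulr0 mulrBl mul1r subr_eq0.
rewrite [in X in _ == X](reindex_inj (addrI s)) /= (eq_bigl _ _ Ss) mulr_sumr.
by apply/eqP/eq_bigr => x Sx; rewrite hM.
Qed.

Variable F : finFieldType.

Definition addchar (psi : F -> algC) :=
  psi 0 = 1 /\ {morph psi : x y / x + y >-> x * y}.

Lemma exists_nontrivial_addchar :
  exists2 psi : F -> algC, addchar psi & exists t, psi t != 1.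
Proof.
have abF : abelian [set: F] by apply/centsP => x _ y _; rewrite /commute !zmodMgE addrC.
have linF i := (char_abelianP [set: F]%G abF i).
have : (1 < #|Iirr [set: F]|)%N.
  by rewrite card_Iirr_abelian // cardsT finNzRing_gt1.
rewrite card_ord => gt1.
pose i : Iirr [set: F] := Ordinal gt1.
have ni0 : i != 0 by [].
exists 'chi_i; first split; first by rewrite -zmod1gE lin_char1.
  by move=> x y; rewrite -zmodMgE lin_charM ?inE.
have /subsetPn[t _] : ~~ ([set: F] \subset cfker 'chi_i) by rewrite subGcfker.
by rewrite cfkerEirr inE lin_char1 // => ?; exists t.
Qed.

Variable psi : F -> algC.
Hypotheses (psiA : addchar psi) (psi_nt : exists t, psi t != 1).

Lemma addchar_neq0 h t : addchar h -> h t != 0.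
Proof.
case=> h0 hD; apply: contra_eqN (hD t (- t)) => /eqP->.
by rewrite subrr h0 mul0r oner_eq0.
Qed.

Lemma addcharN h t : addchar h -> h (- t) = (h t)^-1.
Proof.
move=> hA; apply: (mulfI (addchar_neq0 t hA)); rewrite divff ?addchar_neq0 //.
by case: hA => h0 hD; rewrite -hD subrr.
Qed.

(** [psi] need not be injective, but its kernel contains no nonzero [F]-subspace: the multiples of a
    nonzero [c] exhaust [F]. *)
Lemma psi_scale_eq1 c : (forall t, psi (t * c) = 1) -> c = 0.
Proof.
case: psi_nt => u pu1 H; apply: contraNeq pu1 => c0.
by rewrite -(H (u / c)) divfK.
Qed.

(* Fourier inversion: a character orthogonal to all [psi (c * _)] would vanish
   at [0]. *)
Lemma addchar_dual h : addchar h -> exists c, forall t, h t = psi (c * t).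
Proof.
move=> hA; have [h0 hD] := hA; have [p0 pD] := psiA.
have [/existsP[c /forallP Hc]|/existsPn nH] :=
  boolP [exists c, [forall t, h t == psi (c * t)]].
  by exists c => t; apply/eqP.
have S0 c : \sum_t h t * psi (- (c * t)) = 0.
  have /forallPn[s hs] := nH c.
  rewrite -(eq_bigl _ _ (fun t => in_setT t)).
  apply: (@sum_nontrivial_addchar _ _ s) => [x|x _|]; first by rewrite !inE.
    by rewrite hD mulrDr opprD pD mulrACA.
  rewrite addcharN //; apply: contra hs => /eqP E.
  by rewrite -[h s](divfK (addchar_neq0 (c * s) psiA)) E mul1r.
have: \sum_c \sum_t h t * psi (- (c * t)) = #|F|%:R.
  rewrite exchange_big (bigD1 0) //= [X in _ + X]big1 => [|t t0].
    rewrite addr0 (eq_bigr (fun=> 1)) ?sumr_const // => c _.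
    by rewrite mulr0 oppr0 p0 h0 mulr1.
  rewrite -mulr_sumr.
  suff -> : \sum_c psi (- (c * t)) = 0 by rewrite mulr0.
  have [u pu] := psi_nt.
  rewrite -(eq_bigl _ _ (fun c => in_setT c)).
  (* The shift [- u / t] is the value of [c] at which [psi (- (c * t))] becomes [psi u]. *)
  apply: (@sum_nontrivial_addchar _ _ (- u / t)) => [x|x _|].
  - by rewrite !inE.
  - by rewrite mulrDl opprD pD.
  by rewrite divfK // opprK.
rewrite big1 // => /esym/eqP; rewrite pnatr_eq0 => /eqP cF.
by have := finNzRing_gt1 F; rewrite cF.
Qed.

End AdditiveCharacters.

(** * Matrices supported on a pattern, and their duality pairing *)

Section Pattern.
Variables (F : finFieldType) (n : nat).
Notation mat := 'M[F]_n.+1.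
Implicit Types (P Q R D : rel 'I_n.+1) (X Y L : mat).

Notation pat := (@in_patalg F n).

Lemma patP P X : reflect (forall i j, ~~ P i j -> X i j = 0) (pat P X).
Proof.
apply: (iffP forallP) => [H i j|H i].
  by move/implyP: (forallP (H i) j) => H' /H'/eqP.
by apply/forallP => j; apply/implyP => /H->.
Qed.

Lemma pat0 P : pat P 0. Proof. by apply/patP => i j _; rewrite mxE. Qed.

Lemma patD P X Y : pat P X -> pat P Y -> pat P (X + Y).
Proof.
by move=> /patP PX /patP PY; apply/patP => i j Pij; rewrite mxE PX ?PY ?addr0.
Qed.

Lemma patZ P c X : pat P X -> pat P (c *: X).
Proof. by move=> /patP PX; apply/patP => i j Pij; rewrite mxE PX ?mulr0. Qed.

Lemma patN P X : pat P X -> pat P (- X).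
Proof. by rewrite -scaleN1r; apply: patZ. Qed.

Lemma patB P X Y : pat P X -> pat P Y -> pat P (X - Y).
Proof. by move=> PX /patN; apply: patD. Qed.

Lemma pat_delta P i j : P i j -> pat P (delta_mx i j).
Proof.
move=> Pij; apply/patP => k l; rewrite !mxE.
by case: eqP => // ->; case: eqP => // ->; rewrite Pij.
Qed.

Lemma patS P Q X : subrel P Q -> pat P X -> pat Q X.
Proof. by move=> sPQ /patP PX; apply/patP => i j nQ; apply/PX/(contra _ nQ)/sPQ. Qed.

Lemma patM P Q R X Y :
    (forall i j k, P i j -> Q j k -> R i k) ->
  pat P X -> pat Q Y -> pat R (X * Y).
Proof.
move=> PQR /patP PX /patP QY; apply/patP => i k nR.
rewrite mxE big1 // => j _.
have [Pij|/PX->] := boolP (P i j); last by rewrite mul0r.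
by rewrite QY ?mulr0 //; apply: contra nR; apply: PQR.
Qed.

Definition patset P : {set mat} := [set X | pat P X].

Lemma card_patset P : #|patset P| =
  (#|F| ^ #|[pred u : 'I_n.+1 * 'I_n.+1 | P u.1 u.2]|)%N.
Proof.
rewrite -(card_pffun_on 0 _ F).
pose f (h : {ffun 'I_n.+1 * 'I_n.+1 -> F}) : mat := \matrix_(i, j) h (i, j).
have f_inj : injective f.
  by move=> g h /matrixP E; apply/ffunP => -[i j]; have := E i j; rewrite !mxE.
rewrite -(card_image f_inj); apply: eq_card => X; apply/idP/imageP.
  rewrite inE => /patP PX; exists [ffun u => X u.1 u.2].
    apply/pffun_onP; split=> //; apply/subsetP => u.
    by rewrite !inE ffunE; apply: contraR => /PX->.
  by apply/matrixP => i j; rewrite mxE ffunE.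
case=> h /pffun_onP[/subsetP sh _] ->; rewrite inE; apply/patP => i j nP.
by rewrite mxE; apply: contraNeq nP => h0; have := sh (i, j); rewrite !inE => ->.
Qed.

(** The trace form [tr(L^T X)], through which matrices serve as coordinates for functionals on a
    pattern algebra. *)
Definition dot L X : F := \sum_i \sum_j L i j * X i j.

Lemma dot_linear L c X Y : dot L (c *: X + Y) = c * dot L X + dot L Y.
Proof.
rewrite /dot mulr_sumr -big_split; apply: eq_bigr => i _ /=.
rewrite mulr_sumr -big_split; apply: eq_bigr => j _ /=.
by rewrite !mxE mulrDr mulrCA.
Qed.

Lemma dotD L X Y : dot L (X + Y) = dot L X + dot L Y.
Proof. by have := dot_linear L 1 X Y; rewrite scale1r mul1r. Qed.

Lemma dot0 L : dot L 0 = 0.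
Proof. by rewrite /dot !big1 // => i _; rewrite big1 // => j _; rewrite mxE mulr0. Qed.

Lemma dotZ L c X : dot L (c *: X) = c * dot L X.
Proof. by have := dot_linear L c X 0; rewrite dot0 !addr0. Qed.

Lemma dotN L X : dot L (- X) = - dot L X.
Proof. by rewrite -scaleN1r dotZ mulN1r. Qed.

Lemma dotC L X : dot L X = dot X L.
Proof. by apply: eq_bigr => i _; apply: eq_bigr => j _; rewrite mulrC. Qed.

Lemma dot_delta L i j : dot L (delta_mx i j) = L i j.
Proof.
rewrite /dot (bigD1 i) //= (bigD1 j) //= !mxE !eqxx mulr1.
rewrite !big1 ?addr0 // => [k /negPf ki|k /negPf kj].
  by rewrite big1 // => l _; rewrite mxE ki mulr0.
by rewrite mxE kj andbF mulr0.
Qed.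

Lemma dot_pat_eq0 P L X :
  (forall i j, P i j -> L i j = 0) -> pat P X -> dot L X = 0.
Proof.
move=> L0 /patP PX; rewrite /dot big1 // => i _; rewrite big1 // => j _.
by have [/L0->|/PX->] := boolP (P i j); rewrite ?mul0r ?mulr0.
Qed.

End Pattern.

(** * Pattern groups, their commutators and root elements *)

(* [rho] stands for [GLval]; it is kept abstract because unification of the
   canonical structures of ['GL_n[F]] is prohibitively slow. *)
Section PatternGroup.
Variables (F : finFieldType) (n : nat).
Notation mat := 'M[F]_n.+1.
Variables (gT : finGroupType) (rho : gT -> mat).
Hypothesis rhoM : forall g h, rho (g * h)%g = rho g * rho h.
Hypothesis rho1 : rho 1%g = 1.
Hypothesis rho_inj : injective rho.
Hypothesis rho_unit : forall A : mat, A \is a GRing.unit -> exists g, rho g = A.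
Notation pat := (@in_patalg F n).
Notation patset := (@patset F n).
Implicit Types (P Q R D : rel 'I_n.+1) (X Y L : mat) (g h : gT).

Definition minus_one g : mat := rho g - 1.
(** The default [1] is reached only when no group element has matrix [1 + X]; by [one_plusK] this
    never happens on a closed pattern. *)
Definition one_plus X : gT := odflt 1%g [pick g | minus_one g == X].
Definition patgrp P : {set gT} := [set g | pat P (minus_one g)].

Lemma pat_det D X : closed_pattern D -> pat D X -> \det (1 + X) = 1.
Proof.
(* The matrix is upper unitriangular, whereas [det_trig] is about lower triangular ones, hence the
   transpose. *)
move=> [Dlt _] /patP DX; rewrite -det_tr det_trig.
  rewrite big1 // => i _; rewrite !mxE eqxx DX ?addr0 //.
  by apply/negP => /Dlt; rewrite ltnn.
apply/is_trig_mxP => i j lij; rewrite !mxE DX ?addr0.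
  by case: eqP lij => // ->; rewrite ltnn.
by apply/negP => /Dlt; rewrite ltnNge ltnW.
Qed.

Lemma minus_one_inj : injective minus_one.
Proof. by move=> g h /addIr/rho_inj. Qed.

Lemma minus_oneK : cancel minus_one one_plus.
Proof.
move=> g; rewrite /one_plus; case: pickP => [h /eqP/minus_one_inj//|/(_ g)].
by rewrite eqxx.
Qed.

Lemma one_plusK D X : closed_pattern D -> pat D X -> minus_one (one_plus X) = X.
Proof.
move=> cD DX; have [g Eg] : exists g, rho g = 1 + X.
  by apply: rho_unit; rewrite [_ \in _]unitmxE (pat_det cD DX) unitr1.
by have -> : X = minus_one g; rewrite ?minus_oneK // /minus_one Eg addrC addKr.
Qed.

Lemma rho_minus_one g : rho g = 1 + minus_one g.
Proof. by rewrite addrC subrK. Qed.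

Lemma minus_one1 : minus_one 1%g = 0.
Proof. by rewrite /minus_one rho1 subrr. Qed.

Lemma minus_oneM g h :
  minus_one (g * h)%g = minus_one g + minus_one h + minus_one g * minus_one h.
Proof.
rewrite {1}/minus_one rhoM (rho_minus_one g) (rho_minus_one h).
by rewrite mulrDl mul1r mulrDr mulr1 -[1 + _ + _]addrA [1 + _]addrC addrK addrCA addrA.
Qed.

Lemma mem_patgrp D g : (g \in patgrp D) = pat D (minus_one g).
Proof. by rewrite inE. Qed.

Lemma one_plus_patgrp D X : closed_pattern D -> pat D X -> one_plus X \in patgrp D.
Proof. by move=> cD DX; rewrite mem_patgrp (one_plusK cD). Qed.

Lemma patgrpS P Q : subrel P Q -> patgrp P \subset patgrp Q.
Proof. by move=> sPQ; apply/subsetP => g; rewrite !mem_patgrp; apply: patS. Qed.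

Lemma card_patgrp D : closed_pattern D -> #|patgrp D| = #|patset D|.
Proof.
move=> cD; rewrite -(card_imset _ minus_one_inj); apply: eq_card => X.
apply/imsetP/idP => [[g gD ->]|]; first by rewrite inE -mem_patgrp.
by rewrite inE => DX; exists (one_plus X); rewrite ?one_plus_patgrp // (one_plusK cD).
Qed.

Lemma patgrp_group_set D : closed_pattern D -> group_set (patgrp D).
Proof.
move=> [_ Dt]; apply/group_setP; split=> [|g h].
  by rewrite mem_patgrp minus_one1 pat0.
rewrite !mem_patgrp minus_oneM => Dg Dh; apply: patD; first exact: patD.
exact: (patM Dt Dg Dh).
Qed.

Definition patG D (cD : closed_pattern D) : {group gT} := Group (patgrp_group_set cD).

Lemma closed_pattern_ideal D Q : closed_pattern D -> subrel Q D ->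
  (forall i j k, D i j -> Q j k -> Q i k) -> closed_pattern Q.
Proof. by move=> [Dlt _] sQD DQ; split=> [i j /sQD/Dlt //|i j k /sQD]; apply: DQ. Qed.

Lemma pat_mull D Q A X : (forall i j k, D i j -> Q j k -> Q i k) ->
  pat D (A - 1) -> pat Q X -> pat Q (A * X).
Proof.
move=> DQ DA QX; rewrite -[A](subrK 1) mulrDl mul1r patD //.
exact: patM DA QX.
Qed.

Lemma pat_mulr D Q A X : (forall i j k, Q i j -> D j k -> Q i k) ->
  pat D (A - 1) -> pat Q X -> pat Q (X * A).
Proof.
move=> DQ DA QX; rewrite -[A](subrK 1) mulrDr mulr1 patD //.
exact: patM QX DA.
Qed.

Lemma minus_oneJ g h : minus_one (g ^ h)%g = rho h^-1 * minus_one g * rho h.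
Proof.
rewrite /minus_one conjgE !rhoM mulrBr mulrBl mulr1 mulrA; congr (_ - _).
by rewrite -rhoM mulVg rho1.
Qed.

(** With [g = 1 + x] and [h = 1 + y] one has [g h - h g = x y - y x], and [[~ g, h] - 1] is this
    difference multiplied on the left by the inverse of [h g]. *)
Lemma minus_oneR g h : minus_one [~ g, h] =
  rho (g^-1 * h^-1)%g *
    (minus_one g * minus_one h - minus_one h * minus_one g).
Proof.
have -> : minus_one g * minus_one h - minus_one h * minus_one g =
          rho (g * h)%g - rho (h * g)%g.
  rewrite !rhoM; move: (minus_one g) (minus_one h) (rho_minus_one g) (rho_minus_one h).
  move=> a b -> ->; rewrite !mulrDl !mul1r !mulrDr !mulr1.
  rewrite [1 + b + _]addrA (addrAC 1 b a) [1 + a + (b + _)]addrA.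
  by rewrite opprD addrACA subrr add0r.
have E1 : [~ g, h] = (g^-1 * h^-1 * (g * h))%g by rewrite commgEl conjgE !mulgA.
have E2 : (g^-1 * h^-1 * (h * g) = 1)%g by rewrite -invMg mulVg.
by rewrite mulrBr -!rhoM E2 /minus_one -E1 rho1.
Qed.

(** [Q] spans a two-sided ideal, which is stable under conjugation by the invertible elements
    [1 + x]. *)
Lemma patgrp_normal D Q : forall (cD : closed_pattern D) (cQ : closed_pattern Q),
    subrel Q D -> (forall i j k, D i j -> Q j k -> Q i k) ->
    (forall i j k, Q i j -> D j k -> Q i k) ->
  patG cQ <| patG cD.
Proof.
move=> cD cQ sQD DQ QD; apply/normalP; split; first exact: patgrpS.
move=> g Dg; apply/normP; move: g Dg; apply/subsetP/normsP => g Dg.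
apply/eqP; rewrite eqEcard cardJg leqnn andbT; apply/subsetP => _ /imsetP[h Qh ->].
rewrite /= !mem_patgrp in Qh *; rewrite minus_oneJ.
apply: (pat_mulr QD); first by rewrite -mem_patgrp.
apply: (pat_mull DQ) => //; rewrite -mem_patgrp.
exact: (@groupVr _ (patG cD)).
Qed.

Lemma patgrp_gen P (K : {group gT}) : closed_pattern P ->
    (forall i j t, P i j -> one_plus (t *: delta_mx i j) \in K) ->
  patgrp P \subset K.
Proof.
move=> cP HK; apply/subsetP => g; rewrite mem_patgrp => Pg.
rewrite -[g]minus_oneK; move: (minus_one g) Pg => X PX {g}.
pose le (u v : 'I_n.+1 * 'I_n.+1) := (v.2 <= u.2)%N.
have le_tr : transitive le by move=> u v w /= H1 H2; apply: leq_trans H2 H1.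
have le_tot : total le by move=> u v; apply: leq_total.
pose e := [seq u <- sort le (enum {: 'I_n.+1 * 'I_n.+1}) | P u.1 u.2].
have eP : all (fun u => P u.1 u.2) e by apply: filter_all.
have es : pairwise le e.
  by rewrite -sorted_pairwise // sorted_filter // sort_sorted.
pose term (u : 'I_n.+1 * 'I_n.+1) : mat := X u.1 u.2 *: delta_mx u.1 u.2.
have -> : X = \sum_(u <- e) term u.
  rewrite big_filter (perm_big _ (permEl (perm_sort _ _))) /= big_enum_cond /=.
  rewrite [LHS]matrix_sum_delta pair_big big_mkcond [RHS]big_mkcond /=.
  apply: eq_bigr => -[i j] _ /=; case: ifPn => //.
  by move/patP: PX => PX /PX; rewrite /term /= => ->; rewrite scale0r.
(* The columns are listed in decreasing order, so that all cross terms in the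
   product of the root elements vanish. *)
elim: e eP es => [_ _|u e IHe /= /andP[Pu eP] /andP[ue es]].
  by rewrite big_nil -minus_one1 minus_oneK group1.
have Ps : pat P (\sum_(v <- e) term v).
  rewrite big_seq; apply: (big_rec (fun Y => pat P Y)); first exact: pat0.
  by move=> v Y /(allP eP) Pv PY; rewrite patD // patZ // pat_delta.
have Pt : pat P (term u) by rewrite patZ // pat_delta.
suff -> : one_plus (\sum_(v <- u :: e) term v) =
          (one_plus (term u) * one_plus (\sum_(v <- e) term v))%g.
  by rewrite groupM ?IHe ?HK.
apply: minus_one_inj; rewrite minus_oneM !(one_plusK cP) ?big_cons ?patD //.
rewrite mulr_sumr [X in _ = _ + X]big_seq [X in _ = _ + X]big1 ?addr0 // => v ve.
rewrite -scalerAl -scalerAr [_ * _]mul_delta_mx_cond.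
have /(_ _ ve) uv := allP ue; have /(_ _ ve)/= Pv := allP eP.
case: eqP => [E|_]; last by rewrite mulr0n !scaler0.
by move: uv (cP.1 _ _ Pv); rewrite /le E leqNgt => /negPf->.
Qed.

(** * Coadjoint orbits and stabilisers *)

Section Coadjoint.
Variable D : rel 'I_n.+1.
Hypothesis cD : closed_pattern D.
Variable G : {group gT}.
Hypothesis GE : G = patgrp D :> {set gT}.
Notation dual := (@dual_set F n D).
Implicit Types (f : {ffun mat -> F}).

Definition functional L : {ffun mat -> F} :=
  [ffun X => if pat D X then dot L X else 0].

Lemma dual_setP f : reflect
  ((forall X, ~~ pat D X -> f X = 0) /\
   (forall c X Y, pat D X -> pat D Y -> f (c *: X + Y) = c * f X + f Y))
  (f \in dual).
Proof.
rewrite inE; apply: (iffP andP) => -[H1 H2]; split.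
- by move=> X nX; move/forallP/(_ X)/implyP/(_ nX)/eqP: H1.
- move=> c X Y DX DY; move/forallP/(_ c)/forallP/(_ X)/forallP/(_ Y)/implyP: H2.
  by rewrite DX DY => /(_ isT)/eqP.
- by apply/forallP => X; apply/implyP => /H1->.
apply/forallP => c; apply/forallP => X; apply/forallP => Y.
by apply/implyP => /andP[DX DY]; rewrite H2.
Qed.

Lemma functional_dual L : functional L \in dual.
Proof.
apply/dual_setP; split=> [X /negPf nX|c X Y DX DY]; first by rewrite ffunE nX.
by rewrite !ffunE DX DY patD ?patZ // dot_linear.
Qed.

Lemma functional_inj : {in patset D &, injective functional}.
Proof.
move=> L M; rewrite !inE => /patP DL /patP DM /ffunP E; apply/matrixP => i j.
have [Dij|nD] := boolP (D i j); last by rewrite DL ?DM.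
by have := E (delta_mx i j); rewrite !ffunE pat_delta // !dot_delta.
Qed.

Lemma dual_setE : dual = functional @: patset D.
Proof.
apply/setP => f; apply/idP/imsetP => [|[L _ ->]]; last exact: functional_dual.
case/dual_setP => f0 flin.
exists (\matrix_(i, j) if D i j then f (delta_mx i j) else 0).
  by rewrite inE; apply/patP => i j /negPf nD; rewrite mxE nD.
apply/ffunP => X; rewrite ffunE; case: ifPn => [DX|/f0//].
have f00 : f 0 = 0.
  have := flin 1 0 0 (pat0 _ _) (pat0 _ _).
  by rewrite scaler0 addr0 mul1r => /(canLR (addrK _)); rewrite subrr.
have sumf (I : Type) (r : seq I) (x : I -> mat) : (forall i, pat D (x i)) ->
    f (\sum_(i <- r) x i) = \sum_(i <- r) f (x i).
  move=> Dx; suff [] : f (\sum_(i <- r) x i) = \sum_(i <- r) f (x i) /\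
      pat D (\sum_(i <- r) x i) by [].
  elim: r => [|i r [IH1 IH2]]; first by rewrite !big_nil f00 pat0.
  by rewrite !big_cons patD // -[x i]scale1r flin // scale1r mul1r IH1.
have Dterm i j : pat D (X i j *: delta_mx i j).
  have [Dij|nD] := boolP (D i j); first by rewrite patZ ?pat_delta.
  by move/patP: DX => ->; rewrite // scale0r pat0.
rewrite {1}[X]matrix_sum_delta sumf => [|i]; last first.
  by apply: (big_rec (fun Y => pat D Y)) => [|j Y _]; rewrite ?pat0 //; apply: patD.
apply: eq_bigr => i _; rewrite sumf //; apply: eq_bigr => j _; rewrite mxE.
case: ifPn => [Dij|nD].
  have := flin (X i j) (delta_mx i j) 0 (pat_delta _ Dij) (pat0 _ _).
  by rewrite !addr0 f00 addr0 mulrC => ->; rewrite mulrC.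
by move/patP: DX => ->; rewrite // scale0r f00 mul0r.
Qed.

Definition coadj_rho g f : {ffun mat -> F} :=
  [ffun X => if pat D X then f (rho g^-1%g * X * rho g) else 0].

Definition coadj_orbit_rho f := [set coadj_rho g f | g in G].

Definition coadj_orbits_rho := [set coadj_orbit_rho f | f in dual].

Lemma mem_patG g : (g \in G) = pat D (minus_one g).
Proof. by rewrite GE mem_patgrp. Qed.

Lemma pat_conj g X : g \in G -> pat D (rho g^-1 * X * rho g) = pat D X.
Proof.
have H h Y : h \in G -> pat D Y -> pat D (rho h^-1 * Y * rho h).
  move=> Gh DY.
  have Dh : pat D (rho h^-1 - 1) by rewrite -mem_patG groupV.
  apply: (pat_mulr cD.2); first by rewrite -mem_patG.
  exact: (pat_mull cD.2).
move=> Gg; apply/idP/idP => [/(H g^-1%g)|]; last exact: H.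
rewrite groupV => /(_ Gg).
by rewrite invgK !mulrA -rhoM mulgV rho1 mul1r -mulrA -rhoM mulgV rho1 mulr1.
Qed.

Lemma coadjM g h f : g \in G -> coadj_rho g (coadj_rho h f) = coadj_rho (g * h)%g f.
Proof.
move=> Gg; apply/ffunP => X; rewrite !ffunE pat_conj //.
by case: ifP => // DX; rewrite DX invMg !rhoM !mulrA.
Qed.

Lemma coadj1 f : f \in dual -> coadj_rho 1 f = f.
Proof.
case/dual_setP => f0 _; apply/ffunP => X; rewrite ffunE invg1 rho1 mul1r mulr1.
by case: ifPn => // /f0.
Qed.

Lemma coadj_dual g f : g \in G -> f \in dual -> coadj_rho g f \in dual.
Proof.
move=> Gg /dual_setP[f0 flin]; apply/dual_setP.
split=> [X /negPf nX|c X Y DX DY]; first by rewrite ffunE nX.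
rewrite !ffunE DX DY patD ?patZ // mulrDr mulrDl -scalerAr -scalerAl.
by rewrite flin ?pat_conj.
Qed.

(** The radical of the alternating form [(X, Y) |-> dot L (X * Y - Y * X)]; that [X] itself lies in
    the algebra is left to [stabG]. *)
Definition rad L X := [forall Y, pat D Y ==> (dot L (X * Y - Y * X) == 0)].

Lemma radP L X : reflect (forall Y, pat D Y -> dot L (X * Y - Y * X) = 0) (rad L X).
Proof.
apply: (iffP forallP) => H Y; first by move=> DY; apply/eqP/(implyP (H Y)).
by apply/implyP => /H->.
Qed.

Definition stabG L : {set gT} := [set g in G | rad L (minus_one g)].

(** Substituting [X = g Y] turns invariance under conjugation into [dot L (Y g) = dot L (g Y)], and
    [g Y - Y g] does not change when [1] is subtracted from [g]. *)
Lemma coadj_stab g L : g \in G ->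
  (coadj_rho g (functional L) == functional L) = rad L (minus_one g).
Proof.
move=> Gg; have Dg : pat D (minus_one g) by rewrite -mem_patG.
have comm Y : rho g * Y - Y * rho g = minus_one g * Y - Y * minus_one g.
  move: (minus_one g) (rho_minus_one g) => x ->.
  by rewrite mulrDl mulrDr mul1r mulr1 opprD addrACA subrr add0r.
apply/eqP/radP => [/ffunP E Y DY|R].
  have := E (rho g * Y); rewrite !ffunE pat_conj //.
  rewrite (pat_mull cD.2) // -comm dotD dotN.
  have -> : rho g^-1 * (rho g * Y) * rho g = Y * rho g.
    by rewrite mulrA -rhoM mulVg rho1 mul1r.
  by move=> ->; rewrite subrr.
apply/ffunP => X; rewrite !ffunE pat_conj //; case: ifP => // DX; rewrite DX.
pose Y := rho g^-1 * X.
have DY : pat D Y.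
  by rewrite (pat_mull cD.2) // -mem_patG groupV.
have := R Y DY; rewrite -comm dotD dotN => /eqP; rewrite subr_eq0 => /eqP.
have -> : rho g * Y = X by rewrite mulrA -rhoM mulgV rho1 mul1r.
by rewrite /Y => ->.
Qed.

(** The inverse turns the left coadjoint action into a right action. The identity outside [dual] and
    [G] keeps every map injective, as [is_action] demands. *)
Definition coadj_act_fun f g :=
  if (f \in dual) && (g \in G) then coadj_rho g^-1 f else f.

Lemma coadj_is_action : is_action G coadj_act_fun.
Proof.
split=> [g f1 f2|f g h Gg Gh]; rewrite /coadj_act_fun; last first.
  rewrite Gg Gh groupM // !andbT; case: ifPn => [fd|/negPf->//].
  by rewrite coadj_dual ?groupV // coadjM ?groupV // invMg.
case Gg: (g \in G); last by rewrite !andbF.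
have inv f : f \in dual -> coadj_rho g (coadj_rho g^-1 f) = f.
  by move=> fd; rewrite coadjM // mulgV coadj1.
have Gg' : g^-1%g \in G by rewrite groupV.
rewrite !andbT; case: ifPn => d1; case: ifPn => d2 //.
- by move=> /(congr1 (coadj_rho g)); rewrite !inv.
- by move=> E; rewrite -E coadj_dual in d2.
- by move=> E; rewrite E coadj_dual in d1.
Qed.

Definition coadj_act := Action coadj_is_action.

Lemma coadj_orbitE f : f \in dual -> orbit coadj_act G f = coadj_orbit_rho f.
Proof.
move=> fd; apply/setP => f'; apply/orbitP/imsetP => -[g Gg].
  rewrite /= /coadj_act_fun fd Gg => <-; exists g^-1%g => //.
  by rewrite groupV.
have Gg' := groupVr Gg.
by exists g^-1%g; rewrite //= /coadj_act_fun fd Gg' invgK.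
Qed.

Lemma card_coadj_orbit L :
  (#|stabG L| * #|coadj_orbit_rho (functional L)| = #|G|)%N.
Proof.
rewrite -coadj_orbitE ?functional_dual // card_orbit_in //.
suff -> : stabG L = 'C_G[functional L | coadj_act] by rewrite Lagrange ?subsetIl.
(* Testing the stabiliser at [g^-1] cancels the inverse built into [coadj_act_fun]. *)
apply/setP => g; rewrite -[in RHS]groupV inE in_setI groupV.
case Gg: (g \in G) => //=; rewrite !inE groupV Gg sub1set inE /= /coadj_act_fun.
by rewrite functional_dual groupV Gg invgK coadj_stab.
Qed.

(** The functionals whose orbit has size [m] are partitioned into these orbits, and [functional] is
    injective on [patset D]. *)
Lemma card_coadj_orbits (m : nat) :
  (#|[set L in patset D | #|coadj_orbit_rho (functional L)| == m]| =
   #|[set O in coadj_orbits_rho | #|O| == m]| * m)%N.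
Proof.
pose S := [set f in dual | #|orbit coadj_act G f| == m].
have actS : [acts G, on S | coadj_act].
  apply/subsetP => g Gg; rewrite !inE Gg /=; apply/subsetP => f.
  rewrite !inE /= => /andP[fd om]; have fd' : f \in dual by rewrite inE.
  rewrite (orbit_act_in coadj_act f (subxx G) Gg) om andbT.
  by have := coadj_dual (groupVr Gg) fd'; rewrite /coadj_act_fun fd' Gg inE.
have := card_uniform_partition _ (orbit_partition actS).
have -> : orbit coadj_act G @: S = [set O in coadj_orbits_rho | #|O| == m].
  apply/setP => O; rewrite inE; apply/imsetP/andP => [[f + ->]|[/imsetP[f fd ->]]].
    by rewrite inE => /andP[fd om]; rewrite om coadj_orbitE ?imset_f.
  by rewrite -coadj_orbitE // => om; exists f; rewrite // inE fd.
move=> <- => [|O]; last by rewrite inE => /andP[_ /eqP].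
have -> : S =
    functional @: [set L in patset D | #|coadj_orbit_rho (functional L)| == m].
  apply/setP => f; rewrite inE dual_setE; apply/andP/imsetP.
    case=> /imsetP[L DL ->]; rewrite coadj_orbitE ?functional_dual // => om.
    by exists L => //; rewrite inE DL.
  case=> L; rewrite inE => /andP[DL om] ->.
  by rewrite imset_f ?coadj_orbitE ?functional_dual.
rewrite card_in_imset // => L M; rewrite !inE => /andP[DL _] /andP[DM _].
by apply: functional_inj; rewrite inE.
Qed.

(* In the radical, the constraints coming from [E_jk], [E_j'k] and [E_ij] are
   independent, since they are detected by [E_ij], [E_ij'] and [E_jk]. *)
Lemma card_stab_diamond L i j j' k :
    D i j -> D j k -> D i j' -> D j' k -> j != j' -> L i k != 0 ->
  (#|stabG L| * #|F| ^ 3 <= #|G|)%N.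
Proof.
move=> Dij Djk Dij' Dj'k njj' Lik.
have neq a b : D a b -> (a == b) = false.
  by move=> /cD.1; apply: contraTF => /eqP->; rewrite ltnn.
have Dik := cD.2 _ _ _ Dij Djk.
pose y (u : F * F * F) : mat :=
  u.1.1 *: delta_mx i j + u.1.2 *: delta_mx i j' + u.2 *: delta_mx j k.
have Dy u : pat D (y u) by rewrite !patD ?patZ ?pat_delta.
pose B X Y := dot L (X * Y - Y * X).
have BD X Y Z : B (X + Y) Z = B X Z + B Y Z.
  by rewrite /B mulrDl mulrDr opprD addrACA dotD.
have BZ c X Z : B (c *: X) Z = c * B X Z.
  by rewrite /B -scalerAl -scalerAr -scalerBr dotZ.
have Bd a b c d : B (delta_mx a b) (delta_mx c d) =
    (if b == c then L a d else 0) - (if d == a then L c b else 0).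
  rewrite /B ![_ * _]mul_delta_mx_cond dotD dotN.
  by case: eqP; case: eqP; rewrite ?mulr1n ?mulr0n ?dot0 ?dot_delta.
have B1 u : B (y u) (delta_mx j k) = u.1.1 * L i k.
  rewrite /y !BD !BZ !Bd eqxx (eq_sym j' j) (negPf njj') (eq_sym k j) (neq _ _ Djk).
  by rewrite (eq_sym k i) (neq _ _ Dik) !subr0 !mulr0 !addr0.
have B2 u : B (y u) (delta_mx j' k) = u.1.2 * L i k.
  rewrite /y !BD !BZ !Bd eqxx (negPf njj') (eq_sym k j') (eq_sym k j) (eq_sym k i).
  by rewrite (neq _ _ Djk) (neq _ _ Dj'k) (neq _ _ Dik) !subr0 !mulr0 add0r addr0.
have B3 u : B (y u) (delta_mx i j) = - (u.2 * L i k).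
  rewrite /y !BD !BZ !Bd eqxx (eq_sym j i) (eq_sym j' i) (eq_sym k i).
  by rewrite (neq _ _ Dij) (neq _ _ Dij') (neq _ _ Dik) !subr0 !mulr0 !add0r mulrN.
rewrite GE card_patgrp //.
have -> : (#|stabG L| * #|F| ^ 3 = #|setX (stabG L) [set: F * F * F]|)%N.
  by rewrite cardsX cardsT !card_prod !expnS expn0 muln1 !mulnA.
(* The three detecting values vanish on the radical and recover [u] from [y u], so adding [y u] to
   radical elements is injective from [stabG L] times [F ^ 3] into the algebra. *)
rewrite -(@card_in_imset _ _ (fun v => minus_one v.1 + y v.2)).
  apply: subset_leq_card; apply/subsetP => _ /imsetP[[g u] + ->] /=.
  rewrite !inE /= andbT => /andP[Gg _].
  by apply: patD (Dy u); rewrite -mem_patG.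
move=> [g u] [h v]; rewrite !inE /= !andbT => /andP[_ Rg] /andP[_ Rh] E.
have Buv Z : pat D Z -> B (y u) Z = B (y v) Z.
  move=> DZ; have := congr1 (B ^~ Z) E.
  rewrite /= (BD (minus_one g)) (BD (minus_one h)).
  rewrite [B (minus_one g) Z]/B [B (minus_one h) Z]/B.
  by rewrite (radP _ _ Rg Z DZ) (radP _ _ Rh Z DZ) !add0r.
have uv : u = v.
  move: (Buv _ (pat_delta _ Djk)) (Buv _ (pat_delta _ Dj'k)) (Buv _ (pat_delta _ Dij)).
  rewrite !B1 !B2 !B3 => /(mulIf Lik) E1 /(mulIf Lik) E2 /oppr_inj/(mulIf Lik) E3.
  by case: (u) (v) E1 E2 E3 => [[? ?] ?] [[? ?] ?] /= -> -> ->.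
by rewrite uv in E *; move/addIr/minus_one_inj: E => ->.
Qed.

End Coadjoint.

(** * The square of the pattern algebra, and general facts on kernels and centers of characters *)

Definition mid D : rel 'I_n.+1 := fun i k => [exists j, D i j && D j k].

Lemma midP D i k : reflect (exists j, D i j /\ D j k) (mid D i k).
Proof.
by apply: (iffP existsP) => -[j]; [move/andP|move=> [? ?]]; exists j => //; apply/andP.
Qed.

Lemma mid_sub D : closed_pattern D -> subrel (mid D) D.
Proof. by move=> [_ Dt] i k /midP[j [Dij Djk]]; apply: Dt Djk. Qed.

Lemma mid_closed D : closed_pattern D -> closed_pattern (mid D).
Proof.
move=> cD; apply: (closed_pattern_ideal cD (mid_sub cD)) => i j k Dij.
by move=> /(mid_sub cD) Djk; apply/midP; exists j.
Qed.

Lemma card_patset_split D P : subrel P D ->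
  (#|patset D| = #|patset P| * #|patset [rel i j | D i j && ~~ P i j]|)%N.
Proof.
move=> sPD; rewrite !card_patset -expnD; congr (_ ^ _)%N.
rewrite -(cardID [pred u | P u.1 u.2] [pred u | D u.1 u.2]); congr (_ + _)%N.
  apply: eq_card => u; rewrite !inE.
  by case: (boolP (P _ _)) => [/sPD->|]; rewrite ?andbF.
by apply: eq_card => u; rewrite !inE andbC.
Qed.

(** For an irreducible character, ['Z(chi)] is the preimage of the center of [G / cfker chi]. *)
Lemma cfcenter_commE (G : {group gT}) (i : Iirr G) g : g \in G ->
  (g \in 'Z('chi_i)%CF) = [forall (h | h \in G), [~ g, h]%g \in cfker 'chi_i].
Proof.
move=> Gg; have nK h : h \in G -> h \in 'N(cfker 'chi_i)%g.
  exact: subsetP (normal_norm (cfker_normal _)) h.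
rewrite -(quotientGK (cfker_center_normal _)) inE nK // inE /=.
rewrite cfcenter_eq_center inE mem_quotient //=.
apply/centP/forall_inP => [cg h Gh|cg _ /morphimP[h nKh Gh ->]].
  have := cg (coset _ h) (mem_quotient _ Gh) => /commgP; rewrite -morphR ?nK //=.
  by move/eqP/coset_idr; apply; rewrite groupR ?nK.
by apply/commgP; rewrite -morphR ?nK //= coset_id ?cg.
Qed.

(** The left side is the regular character of [G / K] inflated to [G]. *)
Lemma sum_irr_over_normal (G K : {group gT}) g : K <| G -> g \in G ->
  \sum_(i | K \subset cfker 'chi[G]_i) 'chi_i 1%g * 'chi_i g =
    #|(G : {set gT}) : K|%g%:R *+ (g \in K).
Proof.
move=> nKG Gg; rewrite (reindex _ (mod_Iirr_bij nKG)) /=.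
have := cfRegE (G / K)%g (coset K g); rewrite cfReg_sum sum_cfunE.
have -> : (coset K g == 1%g) = (g \in K).
  have nKg := subsetP (normal_norm nKG) g Gg.
  by apply/eqP/idP => [/(coset_idr nKg)|/coset_id].
rewrite card_quotient ?normal_norm // => <-.
apply: eq_big => [i|i _]; first by rewrite mod_IirrE ?cfker_mod.
by rewrite cfunE mod_IirrE // cfMod1 cfModE.
Qed.

(** * Irreducible characters over functionals on the square *)

Section PatternCharacters.
Variable psi : F -> algC.
Hypotheses (psiA : addchar psi) (psi_nt : exists t, psi t != 1).

(** On each line spanned by some [E_ij] the map [m] is an additive character of [F], so
    [addchar_dual] supplies a constant; these constants are the entries of [L]. *)
Lemma pat_addchar P (m : mat -> algC) : m 0 = 1 ->
    (forall X Y, pat P X -> pat P Y -> m (X + Y) = m X * m Y) ->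
  exists2 L, pat P L & forall X, pat P X -> m X = psi (dot L X).
Proof.
move=> m0 mD.
have [u|c Hc] := @fin_all_exists _ (fun=> F) (fun (u : 'I_n.+1 * 'I_n.+1) c =>
    P u.1 u.2 -> forall t, m (t *: delta_mx u.1 u.2) = psi (c * t)).
  have [Pu|nP] := boolP (P u.1 u.2); last by exists 0.
  have [|c Hc] := addchar_dual psiA psi_nt (h := fun t => m (t *: delta_mx u.1 u.2)).
    split=> [|s t]; first by rewrite scale0r.
    by rewrite scalerDl mD ?patZ ?pat_delta.
  by exists c => _.
exists (\matrix_(i, j) if P i j then c (i, j) else 0).
  by apply/patP => i j /negPf nP; rewrite mxE nP.
move=> X PX; have Pterm i j : pat P (X i j *: delta_mx i j).
  have [Pij|nP] := boolP (P i j); first by rewrite patZ ?pat_delta.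
  by move/patP: PX => ->; rewrite // scale0r pat0.
have Psum i : pat P (\sum_j X i j *: delta_mx i j).
  by apply: (big_rec (fun Y => pat P Y)) => [|j Y _]; [apply: pat0|apply: patD].
pose R Y (y : F) := pat P Y /\ m Y = psi y.
have R0 : R 0 0 by split; [apply: pat0|rewrite m0 psiA.1].
have RD Y1 y1 Y2 y2 : R Y1 y1 -> R Y2 y2 -> R (Y1 + Y2) (y1 + y2).
  by case=> P1 E1 [P2 E2]; split; [apply: patD|rewrite mD // E1 E2 psiA.2].
suff [_ <-] : R (\sum_i \sum_j X i j *: delta_mx i j)
    (dot (\matrix_(i, j) if P i j then c (i, j) else 0) X).
  by rewrite -matrix_sum_delta.
rewrite /dot; apply: (big_ind2 R R0 RD) => i _.
apply: (big_ind2 R R0 RD) => j _; split=> //.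
rewrite mxE; case: ifPn => [Pij|nP]; first exact: (Hc (i, j) Pij).
by move/patP: PX => ->; rewrite // scale0r mul0r m0 psiA.1.
Qed.

Variable D : rel 'I_n.+1.
Hypothesis cD : closed_pattern D.
Variable G : {group gT}.
Hypothesis GE : G = patgrp D :> {set gT}.
(** [J] spans an ideal between the cube and the square of the algebra. It is a parameter because two
    choices occur: [mid2 D] for the whole group, and the empty pattern for a diamond, whose cube
    vanishes. *)
Variable J : rel 'I_n.+1.
Hypotheses (JD2 : subrel J (mid D))
  (DJ : forall i j k, D i j -> mid D j k -> J i k)
  (JD : forall i j k, mid D i j -> D j k -> J i k).

Lemma pat_ideal_closed : closed_pattern J.
Proof.
apply: (closed_pattern_ideal cD) => [i j /JD2|i j k Dij /JD2]; last exact: DJ.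
exact: mid_sub.
Qed.

Notation K := (patG pat_ideal_closed).
Notation Z := (patG (mid_closed cD)).

Lemma mem_Z g : (g \in Z) = pat (mid D) (minus_one g).
Proof. exact: mem_patgrp. Qed.

Lemma mem_K g : (g \in K) = pat J (minus_one g).
Proof. exact: mem_patgrp. Qed.

Lemma sZG : Z \subset G.
Proof. by rewrite GE patgrpS //; apply: mid_sub. Qed.

Lemma sKZ : K \subset Z.
Proof. exact: patgrpS. Qed.

Lemma nKG : K <| G.
Proof.
have -> : G = patG cD by apply: val_inj.
apply: patgrp_normal => [i j /JD2/(mid_sub cD)//|i j k Dij /JD2|i j k /JD2].
  exact: DJ.
exact: JD.
Qed.

(** Only the entries of [L] at [mid D] matter, so [L] may be a functional on the square or any
    extension of it to the algebra. *)
Definition lies_over L (i : Iirr G) :=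
  [forall X, pat (mid D) X ==> ('chi_i (one_plus X) == 'chi_i 1%g * psi (dot L X))].

Lemma lies_overP L i : reflect
  (forall X, pat (mid D) X -> 'chi_i (one_plus X) = 'chi_i 1%g * psi (dot L X))
  (lies_over L i).
Proof.
apply: (iffP forallP) => H X; first by move=> PX; apply/eqP/(implyP (H X)).
by apply/implyP => /H->.
Qed.

Lemma comm_pat_mid X Y : pat D X -> pat D Y -> pat (mid D) (X * Y - Y * X).
Proof.
move=> DX DY; have M : forall i j k, D i j -> D j k -> mid D i k.
  by move=> i j k Dij Djk; apply/midP; exists j.
by apply: patB; apply: (patM M).
Qed.

(** The left factor in [minus_oneR] is [1] plus an element of the algebra, and the latter sends
    [x y - y x] into the cube, hence into the span of [J]. *)
Lemma commutator_mod_ideal g h : g \in G -> h \in G ->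
  exists2 X, pat J X & minus_one [~ g, h]%g =
    minus_one g * minus_one h - minus_one h * minus_one g + X.
Proof.
rewrite !(mem_patG GE) => Dg Dh; set w := _ - _.
have Pw : pat (mid D) w by apply: comm_pat_mid.
exists (minus_one (g^-1 * h^-1)%g * w).
  apply: patM DJ _ Pw; rewrite -(mem_patG GE).
  by rewrite groupM // groupV (mem_patG GE).
by rewrite minus_oneR rho_minus_one mulrDl mul1r.
Qed.

Lemma commutator_in_Z g h : g \in G -> h \in G -> [~ g, h]%g \in Z.
Proof.
move=> Gg Gh; have [X JX E] := commutator_mod_ideal Gg Gh.
rewrite mem_Z E; apply: patD; last exact: patS JX.
by apply: comm_pat_mid; rewrite -(mem_patG GE).
Qed.

(** This makes [Z / K] central in [G / K]: products of an element of the square with one of the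
    algebra lie in the cube. *)
Lemma commutator_in_K g z : g \in G -> z \in Z -> [~ z, g]%g \in K.
Proof.
move=> Gg Zz; have Gz := subsetP sZG _ Zz.
have [X JX E] := commutator_mod_ideal Gz Gg.
rewrite mem_K E; apply: patD => //.
move: Gg Zz; rewrite mem_Z (mem_patG GE) => Dg Pz.
by apply: patB; [apply: patM JD _ _|apply: patM DJ _ _].
Qed.

Lemma Z_sub_center i : K \subset cfker 'chi[G]_i -> Z \subset 'Z('chi_i)%CF.
Proof.
move=> sKk; apply/subsetP => z Zz; rewrite cfcenter_commE ?(subsetP sZG) //.
by apply/forall_inP => g Gg; apply: (subsetP sKk); apply: commutator_in_K.
Qed.

(** On its center [chi] is a multiple of a linear character [xi], here trivial on [K]. Since
    [(1 + X) (1 + Y)] and [1 + (X + Y)] differ by [X * Y], they agree modulo [K]; so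
    [X |-> xi (1 + X)] is additive on the square and [pat_addchar] applies. *)
Lemma exists_lies_over i : K \subset cfker 'chi[G]_i ->
  exists2 L, pat (mid D) L & lies_over L i.
Proof.
move=> sKk; have sZc := Z_sub_center sKk.
have [xi Lxi Dxi] := cfcenter_Res 'chi_i.
have chiE z : z \in Z -> 'chi_i z = 'chi_i 1%g * xi z.
  move=> Zz; have := congr1 (fun f : 'CF(_) => f z) Dxi.
  by rewrite /= cfunE cfResE ?cfcenter_sub ?(subsetP sZc).
have xiK k : k \in K -> xi k = 1.
  move=> Kk; have := chiE k (subsetP sKZ k Kk).
  rewrite cfker1 ?(subsetP sKk) // -[LHS]mulr1 => /(mulfI (irr1_neq0 i)).
  by move->.
have PZ X : pat (mid D) X -> one_plus X \in Z.
  by move=> PX; rewrite mem_Z (one_plusK (mid_closed cD)).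
have [||L PL HL] := @pat_addchar (mid D) (fun X => xi (one_plus X)).
- have -> : one_plus 0 = 1%g :> gT by rewrite -minus_one1 minus_oneK.
  exact: lin_char1.
- move=> X Y PX PY.
  pose u := one_plus (X + Y); pose v := (one_plus X * one_plus Y)%g.
  have Zu : u \in Z by rewrite PZ ?patD.
  have Zv : v \in Z by rewrite groupM ?PZ.
  rewrite -lin_charM ?(subsetP sZc) ?PZ // -/u -/v.
  have -> : v = (u * (u^-1 * v))%g by rewrite mulKVg.
  suff Kuv : (u^-1 * v)%g \in K.
    by rewrite lin_charM ?(subsetP sZc) ?(subsetP sKZ _ Kuv) // (xiK _ Kuv) mulr1.
  have Euv : minus_one (u^-1 * v)%g = rho u^-1%g * (X * Y).
    have -> : X * Y = rho v - rho u.
      rewrite !rho_minus_one minus_oneM /u !(one_plusK (mid_closed cD)) ?patD //.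
      by rewrite opprD addrACA subrr add0r addrC addKr.
    by rewrite mulrBr -!rhoM mulVg rho1.
  rewrite mem_K Euv; apply: (@pat_mull D) => [a b c Dab /JD2||]; first exact: DJ.
    by rewrite -(mem_patG GE) groupV (subsetP sZG).
  by apply: patM PX PY => a b c Dab; apply: DJ; apply: mid_sub Dab.
exists L => //; apply/lies_overP => X PX.
by rewrite chiE ?PZ // HL.
Qed.

Lemma lies_over_ker L i : lies_over L i ->
  (K \subset cfker 'chi_i) = [forall a, forall b, J a b ==> (L a b == 0)].
Proof.
move/lies_overP => HL; apply/idP/forallP => [sKk a|HJ].
  apply/forallP => b; apply/implyP => Jab.
  apply/eqP/(psi_scale_eq1 psi_nt) => t; apply: (mulfI (irr1_neq0 i)).
  have PJ : pat J (t *: delta_mx a b : mat) by rewrite patZ ?pat_delta.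
  rewrite -dot_delta -dotZ -HL ?(patS JD2) // mulr1 cfker1 // (subsetP sKk) //.
  by rewrite mem_K (one_plusK pat_ideal_closed).
apply/subsetP => k; rewrite mem_K => Jk.
rewrite cfkerEirr inE -[k]minus_oneK HL ?(patS JD2) //.
rewrite (@dot_pat_eq0 _ _ J) ?psiA.1 ?mulr1 // => a b Jab.
by apply/eqP; move/forallP/(_ b)/implyP/(_ Jab): (HJ a).
Qed.

(** As [L] vanishes on [J], [[~ g, h]] is in the kernel exactly when [psi] is trivial at
    [dot L (x y - y x)]. Scaling [y] over [F] upgrades this to the vanishing of the form, so the
    center is the coadjoint stabiliser. *)
Lemma cfcenter_lies_over L i : lies_over L i -> K \subset cfker 'chi_i ->
  'Z('chi_i)%CF = stabG D G L.
Proof.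
move=> HL sKk; have LJ : forall a b, J a b -> L a b = 0.
  move: sKk; rewrite (lies_over_ker HL) => /forallP H a b Jab.
  by apply/eqP; move/forallP/(_ b)/implyP/(_ Jab): (H a).
apply/setP => g; rewrite inE.
case Gg: (g \in G); last by apply: contraFF Gg; apply/subsetP/cfcenter_sub.
rewrite cfcenter_commE //=.
have E h : h \in G -> ([~ g, h]%g \in cfker 'chi_i) =
    (psi (dot L (minus_one g * minus_one h - minus_one h * minus_one g)) == 1).
  move=> Gh; have [X JX Ec] := commutator_mod_ideal Gg Gh.
  have := commutator_in_Z Gg Gh; rewrite mem_Z => Zc.
  rewrite cfkerEirr inE -[[~ g, h]%g]minus_oneK (lies_overP _ _ HL) //.
  rewrite -[X in _ == X]mulr1 (inj_eq (mulfI (irr1_neq0 i))) Ec dotD.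
  by rewrite (dot_pat_eq0 LJ JX) addr0.
apply/forall_inP/radP => [H Y DY|H h Gh]; last first.
  by rewrite E // H ?psiA.1 // -(mem_patG GE).
apply: (psi_scale_eq1 psi_nt) => t; rewrite -dotZ.
have DtY : pat D (t *: Y) by rewrite patZ.
have Gh : one_plus (t *: Y) \in G by rewrite (mem_patG GE) (one_plusK cD).
have := H _ Gh; rewrite E // (one_plusK cD) // => /eqP.
by rewrite -scalerAr -scalerAl -scalerBr.
Qed.

(** Commutators lie in [Z], so the quotient by the center of [chi] is abelian and [chi(1) ^ 2] is
    its order, that is, the index of the coadjoint stabiliser. *)
Lemma irr1_sqr_orbit L i : lies_over L i -> K \subset cfker 'chi_i ->
  'chi_i 1%g ^+ 2 = #|coadj_orbit_rho D G (functional D L)|%:R.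
Proof.
move=> HL sKk; rewrite irr1_abelian_bound; last first.
  apply: sub_der1_abelian; rewrite gen_subG; apply/subsetP => _ /imset2P[g h Gg Gh ->].
  by apply: (subsetP (Z_sub_center sKk)); apply: commutator_in_Z.
congr _%:R; have E := card_coadj_orbit cD GE L.
have Zst := cfcenter_lies_over HL sKk.
have pos : (0 < #|stabG D G L|)%N by rewrite -Zst cardG_gt0.
apply/eqP; rewrite -(eqn_pmul2l pos) E -Zst; apply/eqP.
exact: Lagrange (cfcenter_sub _).
Qed.

Lemma card_Z_cosets : #|G : Z| = #|patset [rel i j | D i j && ~~ mid D i j]|.
Proof.
rewrite -divgS ?sZG // GE (card_patgrp cD) (card_patgrp (mid_closed cD)).
rewrite (card_patset_split (mid_sub cD)) mulKn //.
by apply/card_gt0P; exists 0; rewrite inE pat0.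
Qed.

(** The functionals below [chi] form the translate by [L] of those supported on [D] outside
    [mid D]. *)
Lemma card_lies_over L i : pat D L -> lies_over L i ->
  #|[set M in patset D | lies_over M i]| = #|G : Z|.
Proof.
move=> DL /lies_overP HL; rewrite card_Z_cosets -[RHS](card_imset _ (addrI L)).
apply: eq_card => M; rewrite !inE; apply/andP/imsetP => [[DM /lies_overP HM]|[N + ->]].
  exists (M - L); last by rewrite addrC subrK.
  rewrite inE; apply/patP => a b; rewrite /= negb_and negbK => /orP[nD|mab].
    by rewrite (patP _ _ (patB DM DL)).
  apply: (psi_scale_eq1 psi_nt) => t.
  have PJ : pat (mid D) (t *: delta_mx a b : mat) by rewrite patZ ?pat_delta.
  have := HM _ PJ; rewrite HL // => /(mulfI (irr1_neq0 i)) /esym.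
  rewrite !dotZ !dot_delta => E; rewrite !mxE mulrDr psiA.2 E mulrN addcharN //.
  by rewrite divff ?addchar_neq0.
rewrite inE => PN; split.
  by apply: patD DL _; apply: patS PN => a b /andP[].
apply/lies_overP => X PX; rewrite HL // dotC [in RHS]dotC dotD [X in _ + X]dotC.
rewrite (@dot_pat_eq0 _ _ (mid D) N) ?addr0 // => a b mab.
by rewrite (patP _ _ PN) //= mab andbF.
Qed.

(** The inflated regular character of [G / K] is summed over [Z] against [psi (- dot L _)].
    Pointwise, only [z] in [K] contributes, for a total of [#|G|]. Character by character, [chi]
    contributes [#|Z| * chi(1) ^ 2] if it lies over [L], and [0] otherwise by orthogonality. *)
Lemma sum_irr1_lies_over L : (forall a b, J a b -> L a b = 0) ->
  \sum_(i | lies_over L i && (K \subset cfker 'chi[G]_i)) 'chi_i 1%g ^+ 2 = #|G : Z|%:R.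
Proof.
move=> LJ; pose w z := psi (- dot L (minus_one z)).
have nzZ : #|Z|%:R != 0 :> algC := neq0CG _.
apply: (mulfI nzZ); rewrite -natrM Lagrange ?sZG //.
have sum1 : \sum_(z in Z) w z *
    (\sum_(i | K \subset cfker 'chi[G]_i) 'chi_i 1%g * 'chi_i z) = #|G|%:R.
  rewrite -(Lagrange (normal_sub nKG)) natrM mulr_natl.
  transitivity (\sum_(z in K) #|G : K|%:R : algC); last by rewrite sumr_const.
  rewrite [RHS]big_mkcond [LHS]big_mkcond; apply: eq_bigr => z _.
  case: ifPn => Zz; last by rewrite ifN //; apply: contra Zz; apply/subsetP/sKZ.
  rewrite sum_irr_over_normal ?nKG ?(subsetP sZG) //.
  case: ifPn => Kz; last by rewrite mulr0n mulr0.
  by rewrite /w (@dot_pat_eq0 _ _ J) -?mem_K // oppr0 psiA.1 mul1r.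
rewrite -{}sum1; under [RHS]eq_bigr do rewrite mulr_sumr.
rewrite exchange_big /= mulr_sumr big_mkcondl /=; apply: eq_bigr => i sKk.
have [M PM HM] := exists_lies_over sKk.
have -> : \sum_(z in Z) w z * ('chi_i 1%g * 'chi_i z) =
    'chi_i 1%g ^+ 2 * \sum_(X in patset (mid D)) psi (dot M X - dot L X).
  rewrite mulr_sumr (reindex_onto one_plus minus_one) => [|z _]; last first.
    exact: minus_oneK.
  apply: eq_big => [X|X]; last first.
    rewrite mem_Z => /andP[+ /eqP E]; rewrite E => PX.
    by rewrite /w E (lies_overP _ _ HM) // psiA.2 mulrC expr2 -!mulrA.
  rewrite mem_Z inE; apply/andP/idP => [[+ /eqP E]|PX]; first by rewrite E.
  by rewrite (one_plusK (mid_closed cD)).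
case: ifPn => [/lies_overP HL|nHL].
  rewrite mulrC; congr (_ * _); rewrite (card_patgrp (mid_closed cD)) -sumr_const.
  apply: eq_bigr => X; rewrite inE => PX; apply: (mulfI (irr1_neq0 i)).
  rewrite psiA.2 mulrA -(lies_overP _ _ HM) // HL // addcharN //.
  by rewrite -mulrA divff ?addchar_neq0.
have [X] := forallPn nHL; rewrite negb_imply => /andP[PX nE].
rewrite (@sum_nontrivial_addchar _ _ X) ?mulr0 // => [Y|Y|].
- rewrite !inE; apply/idP/idP => [/(patD (patN PX))|]; last exact: patD.
  by rewrite addKr.
- by rewrite inE => PY; rewrite -psiA.2 !dotD opprD addrACA.
apply: contra nE => /eqP; rewrite psiA.2 addcharN // => E.
rewrite (lies_overP _ _ HM) // -[psi (dot M X)](divfK (addchar_neq0 (dot L X) psiA)).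
by rewrite E mul1r.
Qed.

End PatternCharacters.

(** * Pairs with two intermediate vertices, and diamonds *)

Definition mid2 D : rel 'I_n.+1 := fun i k =>
  [exists j, [exists j', [&& j != j', D i j, D j k, D i j' & D j' k]]].

Lemma mid2P D i k : reflect
  (exists j j', [/\ j != j', D i j, D j k, D i j' & D j' k]) (mid2 D i k).
Proof.
apply: (iffP existsP) => [[j /existsP[j' /and5P H]]|[j [j' H]]].
  by exists j, j'.
by exists j; apply/existsP; exists j'; apply/and5P.
Qed.

Lemma mid2_mid D : subrel (mid2 D) (mid D).
Proof. by move=> i k /mid2P[j [j' [_ Dij Djk _ _]]]; apply/midP; exists j. Qed.

Lemma pattern_neq D i j : closed_pattern D -> D i j -> i != j.
Proof. by case=> Dlt _ /Dlt; apply: contraTneq => ->; rewrite ltnn. Qed.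

(** On a path [i, j, l, k] both [j] and [l] are intermediate for [(i, k)] by closure. *)
Lemma mid2_mull D i j k : closed_pattern D -> D i j -> mid D j k -> mid2 D i k.
Proof.
move=> cD Dij Mjk; have Djk := mid_sub cD Mjk.
case/midP: Mjk => l [Djl Dlk]; apply/mid2P; exists j, l; split=> //.
  exact: pattern_neq cD Djl.
exact: cD.2 Djl.
Qed.

Lemma mid2_mulr D i j k : closed_pattern D -> mid D i j -> D j k -> mid2 D i k.
Proof.
move=> cD Mij Djk; have Dij := mid_sub cD Mij.
case/midP: Mij => l [Dil Dlj]; apply/mid2P; exists l, j; split=> //.
  exact: pattern_neq cD Dlj.
exact: cD.2 Djk.
Qed.

Definition diamond (i j j' k : 'I_n.+1) : rel 'I_n.+1 := fun a b =>
  (a, b) \in [:: (i, j); (j, k); (i, j'); (j', k); (i, k)].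

Section Diamond.
Variables (D : rel 'I_n.+1) (i j j' k : 'I_n.+1).
Hypotheses (cD : closed_pattern D) (Dij : D i j) (Djk : D j k).
Hypotheses (Dij' : D i j') (Dj'k : D j' k).

Lemma diamond_sub : subrel (diamond i j j' k) D.
Proof.
have Dik := cD.2 _ _ _ Dij Djk.
by move=> a b; rewrite /diamond !inE => /or4P[||| /orP[]] /eqP[-> ->].
Qed.

Lemma diamond_mul a b c : diamond i j j' k a b -> diamond i j j' k b c ->
  a = i /\ c = k.
Proof.
have [ij jk ij' j'k] : [/\ i != j, j != k, i != j' & j' != k].
  by split; apply: (pattern_neq cD).
have ik : i != k by apply: (pattern_neq cD); apply: cD.2 Dij Djk.
rewrite /diamond !inE.
rewrite !xpair_eqE.
(* Each case left open identifies the two ends of some edge. *)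
move=> /or4P[||| /orP[]] /andP[/eqP-> /eqP->] /or4P[||| /orP[]] /andP[/eqP E /eqP->] //;
  by move: ij jk ij' j'k ik; rewrite E eqxx.
Qed.

Lemma diamond_closed : closed_pattern (diamond i j j' k).
Proof.
split=> [a b /diamond_sub/cD.1 //|a b c ab bc].
by have [-> ->] := diamond_mul ab bc; rewrite /diamond !inE eqxx !orbT.
Qed.

(** No path in a diamond has three edges; [false] is the value of the empty pattern taken for
    [J]. *)
Lemma diamond_mid_mull a b c :
  diamond i j j' k a b -> mid (diamond i j j' k) b c -> false.
Proof.
move=> ab /midP[d [bd dc]]; have [E _] := diamond_mul bd dc.
have := diamond_sub ab => /cD.1; rewrite E; have [-> _] := diamond_mul ab bd.
by rewrite ltnn.
Qed.

Lemma diamond_mid_mulr a b c :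
  mid (diamond i j j' k) a b -> diamond i j j' k b c -> false.
Proof.
move=> /midP[d [ad db]] bc; have [_ E] := diamond_mul ad db.
have := diamond_sub bc => /cD.1; rewrite E; have [_ ->] := diamond_mul db bc.
by rewrite ltnn.
Qed.

End Diamond.

(** * Characters of degree [q] and the double count *)

Section DegreeQ.
Variable D : rel 'I_n.+1.
Hypothesis cD : closed_pattern D.
Variable G : {group gT}.
Hypothesis GE : G = patgrp D :> {set gT}.
Notation q := #|F|.

Lemma orbit_diamond_ge L i k : mid2 D i k -> L i k != 0 ->
  (q ^ 3 <= #|coadj_orbit_rho D G (functional D L)|)%N.
Proof.
case/mid2P=> j [j' [njj' Dij Djk Dij' Dj'k]] Lik.
have := card_stab_diamond cD GE Dij Djk Dij' Dj'k njj' Lik.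
rewrite -(card_coadj_orbit cD GE L) leq_pmul2l //.
apply/card_gt0P; exists 1%g; rewrite inE group1 /= minus_one1; apply/radP => Y _.
by rewrite mul0r mulr0 subrr dot0.
Qed.

End DegreeQ.

(** Otherwise a constituent [chi_y] of the restriction to the diamond subgroup is nontrivial on the
    root element and lies over some [L] with [L i k != 0]. Then [chi_y(1) ^ 2] is an orbit size, at
    least [q ^ 3], although [chi_y(1) <= chi_x(1) = q]. *)
Lemma root_in_ker D (cD : closed_pattern D) (G : {group gT}) (x : Iirr G) i k t :
    G = patgrp D :> {set gT} -> mid2 D i k -> 'chi_x 1%g = #|F|%:R ->
  one_plus (t *: delta_mx i k) \in cfker 'chi_x.
Proof.
move=> GE mik deg; have [psi psiA psi_nt] := exists_nontrivial_addchar F.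
have /mid2P[j [j' [njj' Dij Djk Dij' Dj'k]]] := mik.
pose D' := diamond i j j' k.
have cD' : closed_pattern D' by apply: (diamond_closed cD).
have sD' : subrel D' D by apply: (diamond_sub cD).
pose E := patG cD'; have EE : E = patgrp D' :> {set gT} by [].
have sEG : E \subset G by rewrite EE GE patgrpS.
set z := one_plus _.
have mik' : mid D' i k by apply/midP; exists j; rewrite /D' /diamond !inE !eqxx !orbT.
have mik2 : mid2 D' i k.
  by apply/mid2P; exists j, j'; rewrite /D' /diamond !inE !eqxx !orbT.
have Pz : pat (mid D') (t *: delta_mx i k : mat) by rewrite patZ ?pat_delta.
have Ez : z \in E.
  rewrite mem_patgrp (one_plusK cD') ?(patS (mid_sub cD') Pz) //.
apply: contraT => nz.
have Nchi : 'Res[E] 'chi_x \is a character by rewrite cfRes_char ?irr_char.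
have [y Cy nzy] : exists2 y, y \in irr_constt ('Res[E] 'chi_x) & z \notin cfker 'chi_y.
  apply/exists_inP; apply: contraR nz; rewrite negb_exists_in => /forall_inP nzy.
  have : z \in cfker ('Res[E] 'chi_x).
    rewrite cfkerE // inE Ez; apply/bigcapP => y Cy.
    by have := nzy y Cy; rewrite negbK.
  by rewrite cfkerEchar // inE Ez !cfResE // cfkerEirr inE.
pose J : rel 'I_n.+1 := fun _ _ => false.
have JM : subrel J (mid D') by [].
have DJ a b c : D' a b -> mid D' b c -> J a c :=
  @diamond_mid_mull D i j j' k cD Dij Djk Dij' Dj'k a b c.
have JD a b c : mid D' a b -> D' b c -> J a c :=
  @diamond_mid_mulr D i j j' k cD Dij Djk Dij' Dj'k a b c.
have sKy : patG (pat_ideal_closed cD' JM DJ) \subset cfker 'chi_y.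
  apply/subsetP => g; rewrite mem_patgrp => /patP g0.
  suff -> : g = 1%g by apply: group1.
  by apply: minus_one_inj; rewrite minus_one1; apply/matrixP => a b; rewrite g0 // mxE.
have [L PL HL] := exists_lies_over psiA psi_nt EE JD sKy.
have Lik : L i k != 0.
  apply: contraNneq nzy => L0; rewrite cfkerEirr inE (lies_overP _ _ _ _ HL) //.
  by rewrite dotZ dot_delta L0 mulr0 psiA.1 mulr1.
have := orbit_diamond_ge cD' EE mik2 Lik.
have := irr1_sqr_orbit psiA psi_nt EE JD HL sKy.
have : 'chi_y 1%g <= #|F|%:R.
  by have := char1_ge_constt Nchi Cy; rewrite cfRes1 deg.
rewrite -(@ler_pXn2r _ 2) ?nnegrE ?ler0n ?char1_ge0 ?irr_char // => le2 E2.
rewrite E2 -natrX ler_nat in le2 => /leq_trans/(_ le2).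
by rewrite leq_exp2l ?finNzRing_gt1.
Qed.

Lemma mid2_in_ker D (cD : closed_pattern D) (G : {group gT}) (x : Iirr G) :
    G = patgrp D :> {set gT} -> 'chi_x 1%g = #|F|%:R ->
  patgrp (mid2 D) \subset cfker 'chi_x.
Proof.
move=> GE deg; apply: patgrp_gen => [|i k t mik]; last exact: (root_in_ker cD).
by apply: pat_ideal_closed (@mid2_mid D) _ => // i j k; apply: mid2_mull.
Qed.

(** Pairs of [L] in [Y] and [chi] in [X] over [L] are counted twice: each [chi] has [#|G : Z|]
    partners, and each [L] has [#|G : Z| / q ^ 2]. *)
Theorem card_irr_degree_q D (cD : closed_pattern D) (G : {group gT}) :
    G = patgrp D :> {set gT} ->
  #|[set i : Iirr G | 'chi_i 1%g == #|F|%:R]| =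
  #|[set O in coadj_orbits_rho D G | #|O| == (#|F| ^ 2)%N]|.
Proof.
move=> GE; have [psi psiA psi_nt] := exists_nontrivial_addchar F.
pose JM := @mid2_mid D.
have DJ i j k : D i j -> mid D j k -> mid2 D i k by apply: mid2_mull.
have JD i j k : mid D i j -> D j k -> mid2 D i k by apply: mid2_mulr.
pose K := patG (pat_ideal_closed cD JM DJ); pose Z := patG (mid_closed cD).
pose X := [set i : Iirr G | 'chi_i 1%g == #|F|%:R].
pose Os := [set O in coadj_orbits_rho D G | #|O| == (#|F| ^ 2)%N].
pose Y := [set L in patset D | #|coadj_orbit_rho D G (functional D L)| == (#|F| ^ 2)%N].
have q_gt1 : (1 < #|F|)%N by apply: finNzRing_gt1.
have q2_gt0 : (0 < #|F| ^ 2)%N by rewrite expn_gt0 ltnW.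
have cardY : #|Y| = (#|Os| * #|F| ^ 2)%N := card_coadj_orbits cD GE _.
(* The factor [q ^ 2] turns orbits into functionals, and [#|G : Z|] turns both sides into counts of
   pairs. *)
apply/eqP; rewrite -/X -/Os -(eqn_pmul2r q2_gt0) -cardY -(eqn_pmul2r (indexg_gt0 G Z)).
pose over L (i : Iirr G) := lies_over psi D L i.
have XK i : i \in X -> K \subset cfker 'chi_i.
  by rewrite inE => /eqP; apply: mid2_in_ker.
have YJ L : L \in Y -> forall a b, mid2 D a b -> L a b = 0.
  rewrite inE => /andP[_ /eqP oL] a b mab; apply/eqP; apply: contraT => Lab.
  by have := orbit_diamond_ge cD GE mab Lab; rewrite oL leq_exp2l.
have relXY i L : L \in patset D -> over L i ->
    (i \in X) && (K \subset cfker 'chi_i) =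
    (L \in Y) && (K \subset cfker 'chi_i).
  move=> DL HL; case sKk: (K \subset _); rewrite ?andbF // !andbT !inE.
  have := irr1_sqr_orbit psiA psi_nt GE JD HL sKk; rewrite inE in DL; rewrite DL /=.
  rewrite -(eqr_nat algC) => <-; rewrite natrX eqrXn2 ?ler0n ?char1_ge0 ?irr_char //.
have sumX i : i \in X -> (\sum_(L in Y | over L i) 1 = #|G : Z|)%N.
  move=> Xi; have sKk := XK i Xi.
  have [L PL HL] := exists_lies_over psiA psi_nt GE JD sKk.
  rewrite -(card_lies_over psiA psi_nt cD GE (patS (mid_sub cD) PL) HL).
  rewrite sum1_card; apply: eq_card => M; rewrite [RHS]inE [LHS]inE.
  rewrite -/(over M i); case HM: (over M i); rewrite ?andbF // !andbT.
  apply/idP/idP => [|DM]; first by rewrite inE => /andP[].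
  by have := relXY i M DM HM; rewrite Xi sKk !andbT => <-.
(* All characters over [L] with [K] in the kernel have degree [q], so each contributes [q ^ 2] to
   [sum_irr1_lies_over]. *)
have sumY L : L \in Y -> ((\sum_(i in X | over L i) 1) * #|F| ^ 2 = #|G : Z|)%N.
  move=> YL; have LJ := YJ L YL; apply/eqP; rewrite -(eqr_nat algC).
  rewrite -(sum_irr1_lies_over psiA psi_nt cD GE JM DJ JD LJ) natrM natr_sum mulr_suml.
  apply/eqP; apply: eq_big => [i|i /andP[+ _]]; last first.
    by rewrite inE => /eqP->; rewrite mul1r natrX.
  rewrite andbC -/(over L i); case HL: (over L i) => //=.
  have sKk : K \subset cfker 'chi_i.
    rewrite (lies_over_ker psiA psi_nt cD JM DJ HL); apply/forallP => a.
    by apply/forallP => b; apply/implyP => /LJ->.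
  have DL : L \in patset D by move: YL; rewrite inE => /andP[].
  by have := relXY i L DL HL; rewrite sKk YL !andbT.
apply/eqP; transitivity (\sum_(i in X) (\sum_(L in Y | over L i) 1) * #|F| ^ 2)%N.
  rewrite (eq_bigr _ (fun i Xi => congr1 (muln^~ _) (sumX i Xi))).
  by rewrite sum_nat_const mulnAC mulnA.
rewrite -big_distrl /= (exchange_big_dep (mem Y)) /= => [|i L _ /andP[]//].
rewrite big_distrl -sum_nat_const; apply: eq_bigr => L YL /=.
by rewrite -(sumY L YL); congr (_ * _)%N; apply: eq_bigl => i; rewrite YL.
Qed.

End PatternGroup.

(** * Specialisation to the general linear group *)

Section GeneralLinear.
Variables (F : finFieldType) (n : nat).
Notation gT := (matrix_GLtype__canonical__fingroup_FinGroup n.+1 F).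

Definition GLmx (g : gT) : 'M[F]_n.+1 := GLval g.

Lemma GLmxM g h : GLmx (g * h)%g = GLmx g * GLmx h.
Proof. exact (GL_ME g h). Qed.

Lemma GLmx1 : GLmx 1%g = 1.
Proof. exact (@GL_1E n.+1 F). Qed.

Lemma GLmx_inj : injective GLmx.
Proof. exact: val_inj. Qed.

Lemma GLmx_unit (A : 'M[F]_n.+1) : A \is a GRing.unit -> exists g, GLmx g = A.
Proof. by move=> uA; exists (FinRing.Unit uA). Qed.

Lemma GLmxV (g : {'GL_n.+1[F]}) : GLval g^-1 = GLmx (g : gT)^-1%g.
Proof.
apply: (mulIr (GL_unit g)); transitivity (1 : 'M[F]_n.+1).
  by rewrite -GL_ME mulVg GL_1E.
by rewrite -[RHS]GLmxM mulVg GLmx1.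
Qed.
End GeneralLinear.

Theorem theorem3p9 (F : finFieldType) (n : nat) (D : rel 'I_n.+1)
  (G : {group {'GL_n.+1[F]}}) :
  closed_pattern D ->
  (G : {set _}) = @patgroup_set F n D ->
  #|[set i : Iirr G | 'chi_i 1%g == (#|F|)%:R]| =
  #|[set O in @coadj_orbits F n D G | #|O| == (#|F| ^ 2)%N]|.
Proof.
move=> cD GE.
have GE' : G = patgrp (@GLmx F n) D :> {set _}.
  by rewrite GE; apply/setP => g; rewrite !inE.
have coadjE g f : coadj D g f = coadj_rho (@GLmx F n) D g f.
  by apply/ffunP => X; rewrite !ffunE GLmxV.
have orbE f : coadj_orbit D G f = coadj_orbit_rho (@GLmx F n) D G f.
  by apply: eq_imset => g; apply: coadjE.
have -> : coadj_orbits D G = coadj_orbits_rho (@GLmx F n) D G.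
  by apply: eq_imset => f; apply: orbE.
exact: (card_irr_degree_q (@GLmxM F n) (@GLmx1 F n) (@GLmx_inj F n)
                          (@GLmx_unit F n) cD GE').
Qed.
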